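(* Every SPC matrix is weak irreducible or a sum of weak irreducible SPC matrices. Every PPT matrix is weak irreducible or a sum of weak irreducible PPT matrices.
   Context: $M_k$ denotes the complex $k\times k$ matrices, and $M_k\otimes M_m$ is identified with $M_{km}$ via the Kronecker product. $M_k$ carries the inner product $\langle C,D\rangle=\mathrm{tr}(CD^* )$. A Hermitian projection is an orthogonal projection matrix. Sums are finite. A Hermitian Schmidt decomposition of a Hermitian $A\in M_k\otimes M_m$ is an expression $A=\sum_{i=1}^n\lambda_i\gamma_i\otimes\delta_i$ with real $\lambda_i>0$, where $\{\gamma_1,\dots,\gamma_n\}\subset M_k$ and $\{\delta_1,\dots,\delta_n\}\subset M_m$ are orthonormal sets of Hermitian matrices. A positive semidefinite Hermitian matrix $A\in M_k\otimes M_k$ is SPC (symmetric with positive coefficients) if it has a Hermitian Schmidt decomposition of the form $A=\sum_{i=1}^n\lambda_i\gamma_i\otimes\gamma_i$ with all $\lambda_i>0$. A positive semidefinite Hermitian matrix $A=\sum_i A_i\otimes B_i\in M_k\otimes M_m$ is PPT (positive under partial transposition) if $A^{t_1}=\sum_i A_i^t\otimes B_i$ is also positive semidefinite Hermitian. A positive semidefinite Hermitian matrix $A\in M_k\otimes M_m$ is weak irreducible if, for all Hermitian projections $V_1,V_2\in M_k$ and $W_1,W_2\in M_m$ with $V_1V_2=0$, $W_1W_2=0$, $V_1+V_2=Id\in M_k$ and $W_1+W_2=Id\in M_m$, the equality $A=\sum_{i=1}^2(V_i\otimes W_i)A(V_i\otimes W_i)$ implies that $(V_1\otimes W_1)A(V_1\otimes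 W_1)=0$ or $(V_2\otimes W_2)A(V_2\otimes W_2)=0$. *)

(* Defs.v *)
From HB Require Import structures.
From mathcomp Require Import all_boot all_order all_algebra.
From mathcomp Require Import spectral.
From mathcomp Require Import reals.
From mathcomp Require Export complex.
From mathcomp Require mxtens.

Set Implicit Arguments.
Unset Strict Implicit.
Unset Printing Implicit Defensive.

Import Order.TTheory GRing.Theory Num.Theory.
Local Open Scope ring_scope.
Local Open Scope sesquilinear_scope.
Local Open Scope complex_scope.

(* The Kronecker product of mxtens: the entry of A *t B at row (i, k) and
   column (j, l) is A i j * B k l.  The file mxtens is not imported because its
   notation for iterated tensor powers hides the conjugate transpose M ^t* *)
Notation "A *t B" := (mxtens.tensmx A B)
  (at level 40, left associativity) : ring_scope.

Section Definitions.
Variable R : realType.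
Local Notation C := R[i].

Definition psd n (A : 'M[C]_n) : Prop :=
  A \is hermsymmx /\ forall x : 'cV[C]_n, 0 <= (x ^t* *m A *m x) 0 0.

Definition hermitian_projection n (P : 'M[C]_n) : Prop :=
  P \is hermsymmx /\ P *m P = P.

Definition mxdot n (A B : 'M[C]_n) : C := \tr (A *m B ^t*).

Definition orthonormal_hermitian n k (g : 'I_n -> 'M[C]_k) : Prop :=
  (forall i, g i \is hermsymmx) /\
  (forall i j, mxdot (g i) (g j) = (i == j)%:R).

Definition hermitian_schmidt k m (A : 'M[C]_(k * m)) n
    (lam : 'I_n -> R) (g : 'I_n -> 'M[C]_k) (d : 'I_n -> 'M[C]_m) : Prop :=
  [/\ forall i, 0 < lam i,
      orthonormal_hermitian g,
      orthonormal_hermitian d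
    & A = \sum_(i < n) (lam i)%:C *: (g i *t d i)].

Definition SPC k (A : 'M[C]_(k * k)) : Prop :=
  psd A /\
  exists n (lam : 'I_n -> R) (g : 'I_n -> 'M[C]_k), hermitian_schmidt A lam g g.

(* Partial transposition on the first tensor factor, given entrywise so as not
   to depend on a decomposition of A; see ptrans1_sum *)
Definition ptrans1 k m (A : 'M[C]_(k * m)) : 'M[C]_(k * m) :=
  \matrix_(i, j)
    A (mxtens.mxtens_index
         ((mxtens.mxtens_unindex j).1, (mxtens.mxtens_unindex i).2))
      (mxtens.mxtens_index
         ((mxtens.mxtens_unindex i).1, (mxtens.mxtens_unindex j).2)).

Lemma ptrans1_sum k m n (A_ : 'I_n -> 'M[C]_k) (B_ : 'I_n -> 'M[C]_m) :
  ptrans1 (\sum_(i < n) A_ i *t B_ i) = \sum_(i < n) (A_ i)^T *t B_ i.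
Proof.
apply/matrixP => a b.
case: (mxtens.mxtens_indexP a) => i p; case: (mxtens.mxtens_indexP b) => j q.
rewrite mxE !mxtens.mxtens_indexK /= !summxE; apply: eq_bigr => l _.
by rewrite !mxtens.tensmxE mxE.
Qed.

Definition PPT k m (A : 'M[C]_(k * m)) : Prop := psd A /\ psd (ptrans1 A).

Definition weak_irreducible k m (A : 'M[C]_(k * m)) : Prop :=
  psd A /\
  forall (V1 V2 : 'M[C]_k) (W1 W2 : 'M[C]_m),
    hermitian_projection V1 -> hermitian_projection V2 ->
    hermitian_projection W1 -> hermitian_projection W2 ->
    V1 *m V2 = 0 -> W1 *m W2 = 0 ->
    V1 + V2 = 1%:M -> W1 + W2 = 1%:M ->
    A = (V1 *t W1) *m A *m (V1 *t W1) + (V2 *t W2) *m A *m (V2 *t W2) ->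
    (V1 *t W1) *m A *m (V1 *t W1) = 0 \/ (V2 *t W2) *m A *m (V2 *t W2) = 0.

End Definitions.

(* Main.v *)
(* If A is not weak irreducible, a splitting A = F1 A F1 + F2 A F2 with
   Fi = Vi (x) Wi has two nonzero summands of smaller rank, and one concludes by
   induction on the rank as soon as F1 A F1 inherits SPC or PPT.  For PPT this
   holds because partial transposition turns F1 into V1^T (x) W1.
   For SPC write V = V1, W = W1 and A = sum_i l_i g_i (x) g_i.  Then
   (V (x) 1) A = A (V (x) 1) = (1 (x) W) A = F1 A F1.  Pairing the second factor
   with g_j shows that V and g_j commute and that p_jl = <V g_j, g_l> and
   q_lj = <W g_l, g_j> satisfy l_j p_jl = l_l q_lj.  As p and q are real and
   symmetric, (l_j^2 - l_l^2) p_jl = 0, so p commutes with the coefficients l_i,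
   and V g_j = sum_l p_jl g_l.  Hence
   F1 A F1 = sum_i l_i (V g_i) (x) (V g_i), and diagonalizing the real Gram
   matrix of the Hermitian matrices sqrt(l_i) V g_i makes it a Hermitian Schmidt
   decomposition. *)
Require Import Defs.
From HB Require Import structures.
From mathcomp Require Import all_boot all_order all_algebra.
From mathcomp Require Import spectral.
From mathcomp Require Import boolp reals complex.
From mathcomp Require mxtens.
From mathcomp Require Import ring.

Set Implicit Arguments.
Unset Strict Implicit.
Unset Printing Implicit Defensive.

Import Order.TTheory GRing.Theory Num.Theory.
Local Open Scope ring_scope.
Local Open Scope sesquilinear_scope.
Local Open Scope complex_scope.

(** * Orthogonal diagonalization of real symmetric matrices *)

Section RealSpectral.
Variable R : rcfType.

Lemma rowmx_norm_gt0 n (v : 'rV[R]_n) : v != 0 -> 0 < (v *m v^T) 0 0.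
Proof.
move=> v0; rewrite mxE lt_def sumr_ge0 ?andbT; last first.
  by move=> i _; rewrite mxE -expr2 sqr_ge0.
apply: contraNneq v0 => /eqP; rewrite psumr_eq0; last first.
  by move=> i _; rewrite mxE -expr2 sqr_ge0.
move=> /allP v0; apply/eqP/rowP => j; rewrite mxE.
have := v0 j (mem_index_enum _).
by rewrite mxE /= mulf_eq0 orbb => /eqP.
Qed.

(** Over the closed field [R[i]] an eigenvalue exists, and it is real because [S] is Hermitian
    there. The complex eigenvector need not be real, so the eigenvalue is carried back to [R] as a
    root of the characteristic polynomial. *)
Lemma symmx_unit_eigenvector n (S : 'M[R]_n.+1) : S^T = S ->
  exists d, exists2 v : 'rV_n.+1, v *m S = d *: v & (v *m v^T) 0 0 = 1.
Proof.
move=> Ssym; set SC := map_mx (real_complex R) S.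
have SCh : SC ^t* = SC.
  by apply/matrixP => i j; rewrite !mxE conj_Creal ?complex_real//= -{1}Ssym mxE.
have [a /[dup] ea /eigenvalueP[v veq v0]] := eigenvalue_closed SC (ltn0Sn n).
(* Evaluating the Hermitian form of [SC] at [v] in two ways gives both [a] and its conjugate times
   the nonzero squared norm of [v]. *)
have areal : a \is Num.real.
  have := congr1 (fun M : 'rV_n.+1 => (M *m v ^t*) 0 0) veq.
  have := congr1 (fun M : 'rV_n.+1 => (v *m M ^t*) 0 0) veq.
  rewrite trmx_mul map_mxM /= SCh mulmxA => ->.
  rewrite [X in map_mx _ X]linearZ /= map_mxZ -scalemxAr -scalemxAl !mxE.
  move=> /(mulIf _) E; apply/CrealP; apply: E.
  by have := dotmx_is_dotmx v0; rewrite dotmxE mxE => /lt0r_neq0.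
have /complex_realP[d ad] := areal.
have /eigenvalueP[u ueq u0] : eigenvalue S d.
  move: ea; rewrite ad !eigenvalue_root_char -map_char_poly.
  by rewrite /root horner_map /= (inj_eq (@complexI _)).
have up := rowmx_norm_gt0 u0.
exists d, ((Num.sqrt ((u *m u^T) 0 0))^-1 *: u).
  by rewrite -scalemxAl ueq !scalerA mulrC.
rewrite [X in _ *m X]linearZ /= -scalemxAl -scalemxAr scalerA mxE.
by rewrite -invfM -expr2 sqr_sqrtr ?ltW// mulVf ?gt_eqF.
Qed.

(* The Householder reflection in the hyperplane orthogonal to [v - e_0]. *)
Lemma householder n (v : 'rV[R]_n.+1) : (v *m v^T) 0 0 = 1 ->
  exists H : 'M[R]_n.+1, [/\ H^T = H, H *m H = 1%:M & row 0 H = v].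
Proof.
move=> v1; pose e : 'rV[R]_n.+1 := delta_mx 0 0.
have [w wE] : {w | w = v - e} by exists (v - e).
have [w0|w0] := eqVneq w 0.
  exists 1%:M; rewrite trmx1 mulmx1; split=> //.
  by rewrite row1 -[RHS](subrK e) -wE w0 add0r.
pose c := (w *m w^T) 0 0; have c0 : c != 0 by rewrite gt_eqF// rowmx_norm_gt0.
have wwE : w *m w^T = c%:M by rewrite [LHS]mx11_scalar.
have ewE : e *m w^T = (v 0 0 - 1)%:M.
  by rewrite wE; rewrite [LHS]mx11_scalar -rowE !mxE !eqxx.
(* Both [v] and [e] are unit vectors, so the squared norm of their difference is 2 - 2 v_0. Hence
   the reflection sends [e] to [e + w = v]. *)
have cE : c = - (v 0 0 - 1) * 2.
  rewrite /c wE linearB /= mulmxBr [in LHS]mxE mulmxBl -rowE.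
  rewrite !(mxE, eqxx) /=.
  have -> : \sum_j v 0 j * v^T j 0 = 1 by rewrite -[RHS]v1 mxE.
  rewrite (bigD1 ord0) //= big1 => [|i i0].
    by rewrite !mxE !eqxx /=; ring.
  by rewrite !mxE (negbTE i0) mulr0.
exists (1%:M - (2 / c) *: (w^T *m w)); split.
- by rewrite linearB linearZ /= trmx1 trmx_mul trmxK.
- rewrite mulmxBl mul1mx mulmxBr mulmx1 -scalemxAl -scalemxAr.
  rewrite mulmxA -[_ *m w *m w^T]mulmxA wwE mul_mx_scalar -scalemxAl !scalerA.
  have -> : 2 / c * (2 / c * c) = 2 * (2 / c) by field.
  by rewrite [2 * (2 / c)]mulr_natl mulr2n scalerDl opprB addrK subrK.
- rewrite rowE mulmxBr mulmx1 -scalemxAr mulmxA -/e ewE mul_scalar_mx scalerA.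
  have -> : 2 / c * (v 0 0 - 1) = -1.
    move: (v 0 0 - 1) c0 cE => x c0 cE.
    have x0 : x != 0 by apply: contraNneq c0 => x0; rewrite cE x0 oppr0 mul0r.
    by rewrite cE; field.
  by rewrite scaleNr scale1r opprK wE addrC subrK.
Qed.

(** Induction on the size: conjugating by a reflection whose first row is a unit eigenvector splits
    off a 1 x 1 block, and symmetry clears the first column along with the first row. *)
Lemma symmx_diag n (S : 'M[R]_n) : S^T = S ->
  exists (U : 'M[R]_n) (d : 'rV_n), U *m U^T = 1%:M /\ U *m S *m U^T = diag_mx d.
Proof.
elim: n S => [|n IH] S Ssym.
  by exists 1%:M, 0; split; apply/matrixP => -[].
have [a [v veq v1]] := symmx_unit_eigenvector Ssym.
have [H [Ht HH rowH]] := householder v1.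
have [T TE] : {T : 'M_(1 + n) | T = H *m S *m H} by exists (H *m S *m H).
have Tsym : T^T = T by rewrite TE !trmx_mul Ht Ssym mulmxA.
have T0 j : T 0 j = a * (j == 0)%:R.
  have -> : T 0 j = row 0 T 0 j by rewrite mxE.
  by rewrite TE !row_mul rowH veq -scalemxAl -rowH -row_mul HH row1 !mxE eqxx.
have l0 : lshift n (0 : 'I_1) = 0 by apply/val_inj.
have ulT : ulsubmx T = a%:M.
  by rewrite [LHS]mx11_scalar !mxE l0 T0 eqxx mulr1.
have urT : ursubmx T = 0.
  by apply/rowP => j; rewrite !mxE l0 T0 mulr0.
have dlT : dlsubmx T = 0 by rewrite -[T]Tsym -trmx_ursub urT trmx0.
have [|U [d [UU Ud]]] := IH (drsubmx T); first by rewrite trmx_drsub Tsym.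
pose B : 'M_(1 + n) := block_mx 1%:M 0 0 U.
have BT : B^T = block_mx 1%:M 0 0 U^T by rewrite tr_block_mx !trmx0 trmx1.
have BB : B *m B^T = 1%:M.
  rewrite BT mulmx_block !(mulmx0, mul0mx, mulmx1, addr0, add0r) UU.
  by rewrite -scalar_mx_block.
have BTB : B *m T *m B^T = diag_mx (row_mx a%:M d).
  rewrite BT -[T]submxK ulT urT dlT !mulmx_block.
  rewrite !(mulmx0, mul0mx, mulmx1, mul1mx, addr0, add0r) Ud diag_mx_row.
  by congr block_mx; apply/matrixP => i j; rewrite !ord1 !mxE.
exists (B *m H), (row_mx a%:M d); rewrite trmx_mul Ht; split.
  by rewrite mulmxA -[_ *m H *m H]mulmxA HH mulmx1.
by rewrite -BTB TE !mulmxA.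
Qed.

End RealSpectral.

(** Here F1 A F1 = F1 A, whose row space lies in that of [A]. Equal ranks would give A = X F1 A F1
    for some X, hence A F2 = 0, against the second corner being nonzero. *)
Lemma mxrank_corner_lt (F : fieldType) n (A F1 F2 : 'M[F]_n) :
  F1 *m F1 = F1 -> F1 *m F2 = 0 ->
  A = F1 *m A *m F1 + F2 *m A *m F2 -> F2 *m A *m F2 != 0 ->
  (\rank (F1 *m A *m F1) < \rank A)%N.
Proof.
move=> F11 F12 AE; apply: contraNT; rewrite -leqNgt.
have F1A : F1 *m A *m F1 = F1 *m A.
  by rewrite [in RHS]AE mulmxDr !mulmxA F11 F12 !mul0mx addr0.
rewrite F1A => rk.
have sub : (F1 *m A <= A)%MS := submxMl _ _.
have /submxP[X AX] : (A <= F1 *m A)%MS.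
  by rewrite -(geq_leqif (mxrank_leqif_sup sub)).
by rewrite -mulmxA {1}AX -F1A -!mulmxA F12 !mulmx0.
Qed.

(** * Bilinearity of the Kronecker product and elementary tensors *)

Section Tensor.
Variable R : comPzRingType.

Lemma tensmx_suml k m n p q (X : 'I_n -> 'M[R]_(k, p)) (Y : 'M[R]_(m, q)) :
  (\sum_i X i) *t Y = \sum_i X i *t Y.
Proof.
apply/matrixP => a b; rewrite summxE mxE summxE mulr_suml.
by apply: eq_bigr => i _; rewrite mxE.
Qed.

Lemma tensmx_sumr k m n p q (X : 'M[R]_(k, p)) (Y : 'I_n -> 'M[R]_(m, q)) :
  X *t (\sum_i Y i) = \sum_i X *t Y i.
Proof.
apply/matrixP => a b; rewrite summxE mxE summxE mulr_sumr.
by apply: eq_bigr => i _; rewrite mxE.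
Qed.

Lemma tensmxZl k m p q c (X : 'M[R]_(k, p)) (Y : 'M[R]_(m, q)) :
  (c *: X) *t Y = c *: (X *t Y).
Proof. by apply/matrixP => a b; rewrite !mxE mulrA. Qed.

Lemma tensmxZr k m p q c (X : 'M[R]_(k, p)) (Y : 'M[R]_(m, q)) :
  X *t (c *: Y) = c *: (X *t Y).
Proof. by apply/matrixP => a b; rewrite !mxE mulrCA. Qed.

(** Each matrix unit is a Kronecker product of matrix units. Identities linear in [M] thereby reduce
    to elementary tensors. *)
Lemma tensmx_decomposition k m (M : 'M[R]_(k * m)) :
  exists n (X : 'I_n -> 'M[R]_k) (Y : 'I_n -> 'M[R]_m),
    M = \sum_i X i *t Y i.
Proof.
pose T : finType := ('I_(k * m) * 'I_(k * m))%type.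
pose X (t : T) : 'M[R]_k := M t.1 t.2 *:
  delta_mx (mxtens.mxtens_unindex t.1).1 (mxtens.mxtens_unindex t.2).1.
pose Y (t : T) : 'M[R]_m :=
  delta_mx (mxtens.mxtens_unindex t.1).2 (mxtens.mxtens_unindex t.2).2.
exists #|T|, (fun i => X (enum_val i)), (fun i => Y (enum_val i)).
rewrite -(big_enum_val (fun t => X t *t Y t)) /= [LHS]matrix_sum_delta.
rewrite pair_bigA; apply: eq_bigr => -[a b] _ /=; rewrite tensmxZl; congr (_ *: _).
case: (mxtens.mxtens_indexP a) => i p; case: (mxtens.mxtens_indexP b) => j q.
apply/matrixP => c d.
case: (mxtens.mxtens_indexP c) => i' p'; case: (mxtens.mxtens_indexP d) => j' q'.
rewrite mxtens.tensmxE !mxE !mxtens.mxtens_indexK /= -natrM mulnb.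
rewrite !(can_eq (@mxtens.mxtens_indexK _ _)) !xpair_eqE.
by congr (_ %:R); do 4!case: eqP.
Qed.

End Tensor.

(** * The trace inner product, and Schmidt decompositions from sums of squares *)

Section HilbertSchmidt.
Variable R : realType.
Local Notation C := R[i].
Local Notation conjC := Num.conj.

Lemma hermsymmxP n (A : 'M[C]_n) : (A \is hermsymmx) <-> A ^t* = A.
Proof.
split=> [/is_hermitianmxP|] H; first by rewrite [RHS]H expr0 scale1r.
by apply/is_hermitianmxP; rewrite expr0 scale1r H.
Qed.

Lemma conj_real_complex (x : R) : conjC x%:C = x%:C.
Proof. by rewrite conj_Creal ?complex_real /=. Qed.

Lemma hermsymmxZ n (x : R) (A : 'M[C]_n) :
  A \is hermsymmx -> x%:C *: A \is hermsymmx.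
Proof.
move=> /hermsymmxP Ah; apply/hermsymmxP.
by rewrite linearZ /= map_mxZ /= conj_real_complex Ah.
Qed.

Lemma hermsymmx_tens k m (V : 'M[C]_k) (W : 'M[C]_m) :
  V \is hermsymmx -> W \is hermsymmx -> V *t W \is hermsymmx.
Proof.
move=> /hermsymmxP Vh /hermsymmxP Wh; apply/hermsymmxP.
by rewrite mxtens.trmx_tens mxtens.map_mxT Vh Wh.
Qed.

Lemma hermsymmx_tr k (V : 'M[C]_k) : V \is hermsymmx -> V^T \is hermsymmx.
Proof.
by move=> /hermsymmxP Vh; apply/hermsymmxP; rewrite -{2}Vh map_trmx.
Qed.

Lemma psd_compress n (F A : 'M[C]_n) :
  F \is hermsymmx -> psd A -> psd (F *m A *m F).
Proof.
move=> /hermsymmxP Fh [/hermsymmxP Ah Age]; split.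
  by apply/hermsymmxP; rewrite !trmx_mul !map_mxM Fh Ah mulmxA.
move=> x; have := Age (F *m x).
by rewrite trmx_mul map_mxM Fh !mulmxA.
Qed.

Lemma mxdotE n (A B : 'M[C]_n) : mxdot A B = \sum_i \sum_j A i j * conjC (B i j).
Proof.
rewrite /mxdot /mxtrace; apply: eq_bigr => i _; rewrite mxE.
by apply: eq_bigr => j _; rewrite !mxE.
Qed.

Lemma mxdot_conj n (A B : 'M[C]_n) : conjC (mxdot A B) = mxdot B A.
Proof.
rewrite !mxdotE rmorph_sum; apply: eq_bigr => i _; rewrite rmorph_sum.
by apply: eq_bigr => j _; rewrite rmorphM /= conjCK mulrC.
Qed.

Lemma mxdotZl n c (A B : 'M[C]_n) : mxdot (c *: A) B = c * mxdot A B.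
Proof. by rewrite /mxdot -scalemxAl mxtraceZ. Qed.

Lemma mxdotZr n c (A B : 'M[C]_n) : mxdot A (c *: B) = conjC c * mxdot A B.
Proof. by rewrite -mxdot_conj mxdotZl rmorphM /= mxdot_conj. Qed.

Lemma mxdot_suml n m (A : 'I_m -> 'M[C]_n) (B : 'M[C]_n) :
  mxdot (\sum_i A i) B = \sum_i mxdot (A i) B.
Proof. by rewrite /mxdot mulmx_suml raddf_sum. Qed.

Lemma mxdot_sumr n m (A : 'M[C]_n) (B : 'I_m -> 'M[C]_n) :
  mxdot A (\sum_i B i) = \sum_i mxdot A (B i).
Proof.
rewrite -mxdot_conj mxdot_suml rmorph_sum; apply: eq_bigr => i _.
exact: mxdot_conj.
Qed.

Lemma mxdot_herm_real n (A B : 'M[C]_n) :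
  A \is hermsymmx -> B \is hermsymmx -> conjC (mxdot A B) = mxdot A B.
Proof.
move=> /hermsymmxP Ah /hermsymmxP Bh.
by rewrite mxdot_conj /mxdot Ah Bh mxtrace_mulC.
Qed.

Lemma mxdot_ge0 n (A : 'M[C]_n) : 0 <= mxdot A A.
Proof.
rewrite mxdotE; apply: sumr_ge0 => i _; apply: sumr_ge0 => j _.
exact: mul_conjC_ge0.
Qed.

Lemma mxdot_eq0 n (A : 'M[C]_n) : mxdot A A = 0 -> A = 0.
Proof.
move=> /eqP; rewrite mxdotE psumr_eq0 => [/allP A0|i _]; last first.
  by apply: sumr_ge0 => j _; exact: mul_conjC_ge0.
apply/matrixP => i j; rewrite mxE.
have := A0 i (mem_index_enum _); rewrite /= psumr_eq0; last first.
  by move=> j' _; exact: mul_conjC_ge0.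
by move=> /allP/(_ j (mem_index_enum _)); rewrite mul_conjC_eq0 => /eqP.
Qed.

(* Both sides are the image of the tensor under [id (x) <., D>]. *)
Lemma tensmx_slice k m n n' (X : 'I_n -> 'M[C]_k) (Y : 'I_n -> 'M[C]_m)
    (X' : 'I_n' -> 'M[C]_k) (Y' : 'I_n' -> 'M[C]_m) (D : 'M[C]_m) :
  \sum_i X i *t Y i = \sum_i X' i *t Y' i ->
  \sum_i mxdot (Y i) D *: X i = \sum_i mxdot (Y' i) D *: X' i.
Proof.
pose slice (M : 'M[C]_(k * m)) : 'M[C]_k := \matrix_(a, b) \sum_p \sum_q
  M (mxtens.mxtens_index (a, p)) (mxtens.mxtens_index (b, q)) * conjC (D p q).
have sliceE l (Z : 'I_l -> 'M[C]_k) (T : 'I_l -> 'M[C]_m) :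
    \sum_i mxdot (T i) D *: Z i = slice (\sum_i Z i *t T i).
  apply/matrixP => a b; rewrite summxE mxE.
  under [RHS]eq_bigr do under eq_bigr do rewrite summxE mulr_suml.
  under [RHS]eq_bigr do rewrite exchange_big.
  rewrite exchange_big; apply: eq_bigr => i _; rewrite mxE mxdotE mulr_suml.
  apply: eq_bigr => p _; rewrite mulr_suml; apply: eq_bigr => q _.
  by rewrite mxtens.tensmxE mulrAC [_ * Z i a b]mulrC.
by rewrite !sliceE => ->.
Qed.

(** A real orthogonal change of the family [h] preserves both the sum of squares and Hermitian
    symmetry. Choosing it to diagonalize the Gram matrix makes the new family orthogonal; it remains
    to drop zeros and normalize. *)
Lemma SPC_sum_squares k n (A : 'M[C]_(k * k)) (h : 'I_n -> 'M[C]_k) :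
  (forall i, h i \is hermsymmx) -> psd A -> A = \sum_i h i *t h i -> SPC A.
Proof.
move=> hh Apsd AE; split=> //.
(* The inner products are already real; taking real parts only places the Gram matrix over [R], so
   that [U] is real. *)
pose S : 'M[R]_n := \matrix_(i, j) complex.Re (mxdot (h i) (h j)).
have SE i j : (S i j)%:C = mxdot (h i) (h j).
  by rewrite mxE RRe_real//; apply/CrealP/mxdot_herm_real.
have Ssym : S^T = S.
  by apply/matrixP => i j; apply: complexI; rewrite mxE !SE -mxdot_conj mxdot_herm_real.
have [U [d [UU Ud]]] := symmx_diag Ssym.
have ucol i j : \sum_l (U l i)%:C * (U l j)%:C = (i == j)%:R.
  have /matrixP/(_ i j) := mulmx1C UU; rewrite !mxE => /(congr1 (real_complex R)).
  rewrite rmorph_nat rmorph_sum => <-; apply: eq_bigr => l _.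
  by rewrite !mxE rmorphM.
pose g l := \sum_i (U l i)%:C *: h i.
have gh l : g l \is hermsymmx.
  apply/hermsymmxP; rewrite /g linear_sum /= map_mx_sum.
  by apply: eq_bigr => i _; apply/hermsymmxP/hermsymmxZ.
have gg l m : mxdot (g l) (g m) = (d 0 l)%:C * (l == m)%:R.
  have -> : (d 0 l)%:C * (l == m)%:R = ((U *m S *m U^T) l m)%:C.
    rewrite Ud mxE; case: eqP => [->|_]; first by rewrite mulr1 mulr1n.
    by rewrite mulr0 mulr0n.
  rewrite mxdot_sumr mxE rmorph_sum; apply: eq_bigr => j _.
  rewrite mxdotZr conj_real_complex mxdot_suml !mxE rmorphM mulrC; congr (_ * _).
  rewrite rmorph_sum; apply: eq_bigr => i _.
  by rewrite mxdotZl -SE rmorphM.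
have d0 l : 0 <= d 0 l by have := mxdot_ge0 (g l); rewrite gg eqxx mulr1 ler0c.
have AEg : A = \sum_l g l *t g l.
  rewrite AE; under [RHS]eq_bigr do rewrite tensmx_suml.
  rewrite exchange_big; apply: eq_bigr => i _.
  under eq_bigr do rewrite tensmxZl tensmx_sumr scaler_sumr.
  rewrite exchange_big (bigD1 i) //= [X in _ + X]big1 => [|j ji];
    under eq_bigr do rewrite tensmxZr scalerA; rewrite -scaler_suml ucol.
    by rewrite eqxx scale1r addr0.
  by rewrite eq_sym (negbTE ji) scale0r.
(* As [d 0 l] is the squared norm of [g l], the discarded terms vanish. Dividing the other [g l] by
   their norms leaves [d 0 l] as Schmidt coefficient. *)
pose J := [pred l | d 0 l != 0].
exists #|J|, (fun a => d 0 (enum_val a)),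
  (fun a => (Num.sqrt (d 0 (enum_val a)))^-1%:C *: g (enum_val a)).
have dJ (a : 'I_#|J|) : d 0 (enum_val a) != 0 by exact: (enum_valP a).
have orth : orthonormal_hermitian
    (fun a : 'I_#|J| => (Num.sqrt (d 0 (enum_val a)))^-1%:C *: g (enum_val a)).
  split=> [a|a b]; first exact: hermsymmxZ.
  rewrite mxdotZl mxdotZr conj_real_complex gg (inj_eq enum_val_inj) !mulrA.
  case: eqP => [<-|_]; last by rewrite mulr0.
  rewrite !mulr1 -!rmorphM /= -invfM -expr2 sqr_sqrtr// mulVf//.
split=> //; first by move=> a; rewrite lt_def dJ d0.
transitivity (\sum_(l in J) g l *t g l).
  rewrite AEg (bigID (mem J)) /= [X in _ + X]big1 ?addr0// => l.
  rewrite inE negbK => /eqP dl; rewrite (@mxdot_eq0 _ (g l)) ?mxtens.tens0mx//.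
  by rewrite gg dl mul0r.
rewrite big_enum_val; apply: eq_bigr => a _.
rewrite tensmxZl tensmxZr !scalerA -!rmorphM /= -invfM -expr2 sqr_sqrtr//.
by rewrite divff// scale1r.
Qed.
End HilbertSchmidt.

(** * Compression by tensor projections *)

Section TensorProjections.
Variable R : realType.
Local Notation C := R[i].
Local Notation conjC := Num.conj.

(** On an elementary tensor this is (V X V)^T = V^T X^T V^T in the first factor; the order reversal
    is harmless since [V] stands on both sides. *)
Lemma ptrans1_tens_mul k m (V : 'M[C]_k) (W : 'M[C]_m) (A : 'M[C]_(k * m)) :
  ptrans1 ((V *t W) *m A *m (V *t W)) =
  (V^T *t W) *m ptrans1 A *m (V^T *t W).
Proof.
have [n [X [Y ->]]] := tensmx_decomposition A.
rewrite ptrans1_sum !mulmx_sumr !mulmx_suml.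
under eq_bigr do rewrite !mxtens.tensmx_mul.
rewrite ptrans1_sum; apply: eq_bigr => i _.
by rewrite !mxtens.tensmx_mul !trmx_mul mulmxA.
Qed.

Lemma schmidt_tens_proj k n (lam : 'I_n -> R) (g : 'I_n -> 'M[C]_k)
    (A : 'M[C]_(k * k)) (V W : 'M[C]_k) :
  hermitian_schmidt A lam g g ->
  hermitian_projection V -> W \is hermsymmx ->
  A *m (V *t 1%:M) = (V *t 1%:M) *m A ->
  (1%:M *t W) *m A = (V *t 1%:M) *m A ->
  (forall i, V *m g i \is hermsymmx) /\
  (V *t 1%:M) *m A = \sum_i (lam i)%:C *: ((V *m g i) *t (V *m g i)).
Proof.
move=> [lam0 [gh go] _ AE] [/hermsymmxP Vh VV] /hermsymmxP Wh AV WA.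
pose a i := (lam i)%:C; have a0 i : a i != 0.
  by rewrite (inj_eq (@complexI _)) gt_eqF.
have aconj i : conjC (a i) = a i := conj_real_complex (lam i).
have gE i : (g i) ^t* = g i by apply/hermsymmxP.
have VAE : (V *t 1%:M) *m A = \sum_i (a i *: (V *m g i)) *t g i.
  rewrite AE mulmx_sumr; apply: eq_bigr => i _.
  by rewrite -scalemxAr mxtens.tensmx_mul mul1mx tensmxZl.
have slice X : \sum_i mxdot (g i) X *: (a i *: (V *m g i)) =
   \sum_i mxdot (W *m g i) X *: (a i *: g i).
  apply: tensmx_slice; rewrite -VAE -WA AE mulmx_sumr; apply: eq_bigr => i _.
  by rewrite -scalemxAr mxtens.tensmx_mul mul1mx tensmxZl.
(* By orthonormality, slicing against [g j] isolates the j-th term. *)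
have pick j (Z : 'I_n -> 'M[C]_k) : \sum_i mxdot (g i) (g j) *: Z i = Z j.
  rewrite (bigD1 j) //= go eqxx scale1r big1 ?addr0// => i ij.
  by rewrite go (negbTE ij) scale0r.
have comm j : V *m g j = g j *m V.
  have: \sum_i mxdot (g i) (g j) *: (a i *: (V *m g i)) =
        \sum_i mxdot (g i) (g j) *: (a i *: (g i *m V)).
    apply: tensmx_slice; rewrite -VAE -AV AE mulmx_suml; apply: eq_bigr => i _.
    by rewrite -scalemxAl mxtens.tensmx_mul mulmx1 tensmxZl.
  by rewrite !pick => /scalerI; apply.
have Vgh j : V *m g j \is hermsymmx.
  by apply/hermsymmxP; rewrite trmx_mul map_mxM gE Vh comm.
split=> //.
pose p j l := mxdot (V *m g j) (g l); pose q l j := mxdot (W *m g l) (g j).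
have Vg j : a j *: (V *m g j) = \sum_l (a l * q l j) *: g l.
  rewrite -(pick j (fun j => a j *: (V *m g j))) slice.
  by apply: eq_bigr => l _; rewrite scalerA mulrC.
have apq j l : a j * p j l = a l * q l j.
  rewrite /p -mxdotZl Vg mxdot_suml (bigD1 l) //= big1 => [|i il].
    by rewrite mxdotZl go eqxx mulr1 addr0.
  by rewrite mxdotZl go (negbTE il) mulr0.
have psym j l : p j l = p l j.
  rewrite /p /mxdot !gE [in RHS]comm [in RHS]mxtrace_mulC mulmxA.
  by rewrite mxtrace_mulC mulmxA comm.
have preal j l : conjC (p j l) = p j l by exact: mxdot_herm_real.
(* Commutation of [W] with the [g j] is not at hand, so [q] is at first only Hermitian; [apq] makes
   it real because [a] and [p] are. *)
have qsym j l : q l j = q j l.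
  have qconj : conjC (q l j) = q j l.
    by rewrite mxdot_conj /q /mxdot trmx_mul map_mxM !gE Wh mulmxA mxtrace_mulC mulmxA.
  apply: (mulfI (a0 l)); rewrite -apq -qconj -[a l in RHS]aconj -rmorphM /= -apq.
  by rewrite rmorphM /= aconj preal.
(* Exchanging j and l in [apq] yields a_j^2 p_jl = a_j a_l q_lj = a_l^2 p_jl. The factor a_j + a_l
   is positive and cancels, leaving first powers. *)
have pa j l : a j * p j l = a l * p j l.
  have aa : a j + a l != 0.
    by rewrite -rmorphD (inj_eq (@complexI _)) gt_eqF ?addr_gt0.
  have plq : a l * p j l = a j * q l j by rewrite psym apq qsym.
  apply: (mulfI aa); rewrite !mulrDl [a j * (a l * _)]mulrCA addrC; congr (_ + _).
  by rewrite apq plq mulrCA.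
have VgE j : V *m g j = \sum_l p j l *: g l.
  apply: (scalerI (a0 j)); rewrite Vg scaler_sumr; apply: eq_bigr => l _.
  by rewrite scalerA apq.
(* Idempotence supplies a second [V] in the first factor. On the right-hand side, the [V] of the
   second factor is moved to the first through [p], which is symmetric and commutes with the
   coefficients. *)
have -> : (V *t 1%:M) *m A = \sum_l (a l *: (V *m (V *m g l))) *t g l.
  by rewrite VAE; apply: eq_bigr => l _; rewrite mulmxA VV.
under [RHS]eq_bigr => j _.
  rewrite -/(a j) {2}VgE tensmx_sumr scaler_sumr.
  under eq_bigr => l _ do rewrite tensmxZr scalerA pa psym -tensmxZl -scalerA.
  over.
rewrite exchange_big; apply: eq_bigr => l _ /=.
rewrite -tensmx_suml -scaler_sumr [V *m g l]VgE mulmx_sumr.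
by under eq_bigr do rewrite -scalemxAr.
Qed.

(** * Splittings of a matrix into two corners, and induction on the rank *)

Definition tens_split k m (A : 'M[C]_(k * m)) (V1 V2 : 'M[C]_k)
    (W1 W2 : 'M[C]_m) : Prop :=
  [/\ [/\ hermitian_projection V1, hermitian_projection V2,
          hermitian_projection W1 & hermitian_projection W2],
      V1 *m V2 = 0 /\ W1 *m W2 = 0,
      V1 + V2 = 1%:M /\ W1 + W2 = 1%:M
    & A = (V1 *t W1) *m A *m (V1 *t W1) + (V2 *t W2) *m A *m (V2 *t W2)].

Lemma complement_mul0 n (P Q : 'M[C]_n) :
  P *m P = P -> P + Q = 1%:M -> Q *m P = 0.
Proof.
by move=> PP PQ; rewrite -(addKr P Q) PQ mulmxDl mulNmx mul1mx PP addNr.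
Qed.

Lemma tens_split_sym k m (A : 'M[C]_(k * m)) V1 V2 W1 W2 :
  tens_split A V1 V2 W1 W2 -> tens_split A V2 V1 W2 W1.
Proof.
move=> [[hV1 hV2 hW1 hW2] _ [V12 W12] AE].
rewrite /tens_split [V2 + V1]addrC [W2 + W1]addrC [X in A = X]addrC.
split=> //; split; apply: complement_mul0 => //.
  by case: hV1.
by case: hW1.
Qed.

(** A projection on one factor alone already fixes the first corner and kills the second. *)
Lemma tens_split_mul k m (A : 'M[C]_(k * m)) V1 V2 W1 W2 :
  tens_split A V1 V2 W1 W2 ->
  let B := (V1 *t W1) *m A *m (V1 *t W1) in
  [/\ (V1 *t 1%:M) *m A = B, A *m (V1 *t 1%:M) = B & (1%:M *t W1) *m A = B].
Proof.
move=> [[[_ VV] _ [_ WW] _] [V12 W12] [V1D W1D] AE] B.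
have V21 := complement_mul0 VV V1D; have W21 := complement_mul0 WW W1D.
split; rewrite {1}AE ?mulmxDl ?mulmxDr ?mulmxA -?[_ *m _ *m (V1 *t 1%:M)]mulmxA
  !mxtens.tensmx_mul !(mul1mx, mulmx1) ?VV ?WW ?V12 ?V21 ?W12;
  by rewrite ?mxtens.tens0mx ?mxtens.tensmx0 ?mul0mx ?mulmx0 addr0.
Qed.

Lemma tens_split_rank k m (A : 'M[C]_(k * m)) V1 V2 W1 W2 :
  tens_split A V1 V2 W1 W2 -> (V2 *t W2) *m A *m (V2 *t W2) <> 0 ->
  (\rank ((V1 *t W1) *m A *m (V1 *t W1)) < \rank A)%N.
Proof.
move=> [[[_ VV] _ [_ WW] _] [V12 W12] _ AE] /eqP A2.
apply: mxrank_corner_lt AE A2; rewrite mxtens.tensmx_mul ?VV ?WW ?V12//.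
exact: mxtens.tens0mx.
Qed.

(** Strong induction on the rank, for any class of positive semidefinite matrices stable under
    passing to a corner of a splitting. When both corners are nonzero, each has smaller rank than
    [A]. *)
Lemma weak_irreducible_sum k m (P : 'M[C]_(k * m) -> Prop) :
  (forall A, P A -> psd A) ->
  (forall A V1 V2 W1 W2, P A -> tens_split A V1 V2 W1 W2 ->
     P ((V1 *t W1) *m A *m (V1 *t W1))) ->
  forall A, P A -> exists (n : nat) (B : 'I_n -> 'M[C]_(k * m)),
    [/\ (0 < n)%N, A = \sum_(i < n) B i
      & forall i, P (B i) /\ weak_irreducible (B i)].
Proof.
move=> Ppsd Psplit A; have [r] := ubnP (\rank A).
elim: r A => // r IH A rA PA.
(* Without a splitting into nonzero corners, [A] is weak irreducible and forms a one-term sum. The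
   zero matrix falls in this case, so the sum is never empty. *)
have [[V1 [V2 [W1 [W2 [sp A1 A2]]]]]|irr] := pselect (exists V1 V2 W1 W2,
  [/\ tens_split A V1 V2 W1 W2, (V1 *t W1) *m A *m (V1 *t W1) <> 0
    & (V2 *t W2) *m A *m (V2 *t W2) <> 0]); last first.
  exists 1%N, (fun _ => A); rewrite big_ord1; split=> // _; split=> //.
  split; first exact: Ppsd.
  move=> V1 V2 W1 W2 hV1 hV2 hW1 hW2 V12 W12 V1D W1D AE.
  have [|A1] := pselect ((V1 *t W1) *m A *m (V1 *t W1) = 0); first by left.
  have [|A2] := pselect ((V2 *t W2) *m A *m (V2 *t W2) = 0); first by right.
  by case: irr; exists V1, V2, W1, W2.
have sp' := tens_split_sym sp.
have [n1 [B1 [n1_gt0 AB1 PB1]]] := IH _ (leq_trans (tens_split_rank sp A2) rA)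
  (Psplit _ _ _ _ _ PA sp).
have [n2 [B2 [n2_gt0 AB2 PB2]]] := IH _ (leq_trans (tens_split_rank sp' A1) rA)
  (Psplit _ _ _ _ _ PA sp').
exists (n1 + n2)%N, (fun i => match split i with inl i => B1 i | inr i => B2 i end).
split.
- by rewrite addn_gt0 n1_gt0.
- have [_ _ _ ->] := sp; rewrite AB1 AB2 big_split_ord.
  congr (_ + _); apply: eq_bigr => i _.
    by rewrite (unsplitK (inl i)).
  by rewrite (unsplitK (inr i)).
- by move=> i; case: (split i).
Qed.

Lemma SPC_tens_split k (A : 'M[C]_(k * k)) V1 V2 W1 W2 :
  SPC A -> tens_split A V1 V2 W1 W2 ->
  SPC ((V1 *t W1) *m A *m (V1 *t W1)).
Proof.
move=> [Apsd [n [lam [g sch]]]] sp.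
have [AV VA WA] := tens_split_mul sp.
have [[hV1 _ [hW1 _] _] _ _ _] := sp; have [hV _] := hV1.
have [||h E] := schmidt_tens_proj sch hV1 hW1.
- by rewrite VA.
- by rewrite WA.
have Bpsd : psd ((V1 *t W1) *m A *m (V1 *t W1)).
  by apply: psd_compress => //; apply: hermsymmx_tens.
have [lam0 _ _ _] := sch.
(* The square roots absorb the coefficients, giving a plain sum of squares. *)
apply: (@SPC_sum_squares _ _ _ _ (fun i => (Num.sqrt (lam i))%:C *: (V1 *m g i))) => //.
  by move=> i; apply: hermsymmxZ.
rewrite -AV E; apply: eq_bigr => i _.
by rewrite tensmxZl tensmxZr scalerA -rmorphM -expr2 sqr_sqrtr// ltW.
Qed.

Lemma PPT_tens_split k m (A : 'M[C]_(k * m)) V1 V2 W1 W2 :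
  PPT A -> tens_split A V1 V2 W1 W2 ->
  PPT ((V1 *t W1) *m A *m (V1 *t W1)).
Proof.
move=> [Apsd Atpsd] [[[hV _] _ [hW _] _] _ _ _].
split; first by apply: psd_compress => //; apply: hermsymmx_tens.
rewrite ptrans1_tens_mul; apply: psd_compress => //.
by apply: hermsymmx_tens => //; apply: hermsymmx_tr.
Qed.

End TensorProjections.

Theorem corollary3p7 (R : realType) :
  (forall (k : nat) (A : 'M[R[i]]_(k * k)), SPC A ->
     weak_irreducible A \/
     exists (n : nat) (B : 'I_n -> 'M[R[i]]_(k * k)),
       [/\ (0 < n)%N,
           A = \sum_(i < n) B i
         & forall i, SPC (B i) /\ weak_irreducible (B i)])
  /\
  (forall (k m : nat) (A : 'M[R[i]]_(k * m)), PPT A ->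
     weak_irreducible A \/
     exists (n : nat) (B : 'I_n -> 'M[R[i]]_(k * m)),
       [/\ (0 < n)%N,
           A = \sum_(i < n) B i
         & forall i, PPT (B i) /\ weak_irreducible (B i)]).
Proof.
(* The second alternative always holds, since one-term sums are allowed. *)
split=> [k A SA|k m A PA]; right.
  apply: (@weak_irreducible_sum R k k (@SPC R k)) SA => [? []|] //.
  exact: SPC_tens_split.
apply: (@weak_irreducible_sum R k m (@PPT R k m)) PA => [? []|] //.
exact: PPT_tens_split.
Qed.
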